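(* Let $x^{*}:\mathbb{R}_{\mathcal F}\to\mathbb{R}$ be a map. Then $x^{*}$ is a linear continuous functional on $\mathbb{R}_{\mathcal F}$ (continuity with respect to the metric $D$) if and only if there exists a linear functional $L:\overline{C}[0,1]\to\mathbb{R}$ such that $$x^{*}(x)=L(x_{-}+x_{+})\quad\text{for all } x\in\mathbb{R}_{\mathcal F},$$ and such that the restriction $L|_{IC[0,1]}$ is continuous on $IC[0,1]$ with respect to uniform convergence.
   Context: Fuzzy numbers: $\mathbb{R}_{\mathcal F}$ is the set of all functions $u:\mathbb{R}\to[0,1]$ such that (i) there is $x_u\in\mathbb{R}$ with $u(x_u)=1$; (ii) $u(tx+(1-t)y)\ge\min\{u(x),u(y)\}$ for all $t\in[0,1]$, $x,y\in\mathbb{R}$; (iii) $u$ is upper semicontinuous on $\mathbb{R}$; (iv) the closure of $\{x\in\mathbb{R}: u(x)>0\}$ is compact. Level sets: for $0<r\le 1$, $[u]^r=\{x\in\mathbb{R}:u(x)\ge r\}$, and $[u]^0=\overline{\{x\in\mathbb{R}:u(x)>0\}}$. Each $[u]^r$ is a compact interval, written $[u]^r=[u_-(r),u_+(r)]$; this defines functions $u_-,u_+:[0,1]\to\mathbb{R}$, which belong to the space $\overline{C}[0,1]$ below. Operations: $(u\oplus v)(x)=\sup_{y+z=x}\min\{u(y),v(z)\}$; for $\lambda\in\mathbb{R}$, $(\lambda\odot u)(x)=u(x/\lambda)$ if $\lambda\ne0$, and $0\odot u=\widetilde 0:=\chi_{\{0\}}$. Equivalently, $[u\oplus v]^r=[u]^r+[v]^r$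 and $[\lambda\odot u]^r=\lambda[u]^r$ for all $r\in[0,1]$. Metric: $D(u,v)=\sup_{r\in[0,1]}\max\{|u_-(r)-v_-(r)|,|u_+(r)-v_+(r)|\}$. A functional $A:\mathbb{R}_{\mathcal F}\to\mathbb{R}$ is called linear if $A(x\oplus y)=A(x)+A(y)$ and $A(\lambda\odot x)=\lambda A(x)$ for all $x,y\in\mathbb{R}_{\mathcal F}$ and all $\lambda\in\mathbb{R}$. Continuous means continuous at every point. $\overline{C}[0,1]$ is the real Banach space of all bounded functions $f:[0,1]\to\mathbb{R}$ that are left continuous at each point of $(0,1]$, have a right limit at each point of $[0,1)$, and are right continuous at $0$, with the uniform norm $\|f\|=\sup\{|f(x)|:x\in[0,1]\}$. $IC[0,1]=\{f\in\overline{C}[0,1]: f\text{ is increasing on }[0,1]\}$, where increasing means nondecreasing. Linearity of $L:\overline{C}[0,1]\to\mathbb{R}$ is the usual one for vector spaces; $L$ itself is not required to be continuous on $\overline{C}[0,1]$. *)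

(* Defs.v *)
From HB Require Import structures.
From mathcomp Require Import all_boot all_order all_algebra.
From mathcomp Require Import all_classical all_reals all_analysis.
From mathcomp Require Import ring lra.

Set Implicit Arguments.
Unset Strict Implicit.
Unset Printing Implicit Defensive.

Import Order.TTheory GRing.Theory Num.Theory.
Import numFieldNormedType.Exports.

Local Open Scope classical_set_scope.
Local Open Scope ring_scope.

(* The dual of the library's lower_semicontinuous, for real-valued functions. *)
Definition upper_semicontinuous (R : realType) (u : R -> R) : Prop :=
  forall x a, u x < a -> \forall y \near x, u y < a.

Record is_fuzzy_number (R : realType) (u : R -> R) : Prop := IsFuzzyNumber {
  fuzzy_range : forall x, 0 <= u x <= 1;
  fuzzy_normal : exists x, u x = 1;
  fuzzy_quasiconcave : forall t x y, 0 <= t <= 1 ->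
    Num.min (u x) (u y) <= u (t * x + (1 - t) * y);
  fuzzy_usc : upper_semicontinuous u;
  fuzzy_compact_support : compact (closure [set x | 0 < u x])
}.

Record fuzzy_number (R : realType) : Type := FuzzyNumber {
  fuzzy_fun :> R -> R;
  fuzzy_numberP : is_fuzzy_number fuzzy_fun
}.

HB.instance Definition _ (R : realType) := gen_eqMixin (fuzzy_number R).
HB.instance Definition _ (R : realType) := gen_choiceMixin (fuzzy_number R).

Definition level (R : realType) (u : R -> R) (r : R) : set R :=
  if r == 0 then closure [set x | 0 < u x] else [set x | r <= u x].

(* Zadeh's extension principle: the supremum over all y + z = x; it is a
   nonempty subset of [0, 1], so the real-valued sup is the intended one. *)
Definition fuzzy_add_fun (R : realType) (u v : R -> R) : R -> R := fun x =>
  sup [set m | exists y z, y + z = x /\ m = Num.min (u y) (v z)].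

Definition fuzzy_scale_fun (R : realType) (l : R) (u : R -> R) : R -> R :=
  if l == 0 then \1_[set 0] else fun x => u (x / l).

Section level_sets.
Context {R : realType}.
Implicit Types (u v : R -> R) (r s x y : R).

Lemma fuzzy_number_eq (u v : fuzzy_number R) : u =1 v -> u = v.
Proof.
case: u v => [u hu] [v hv] /= /funext uv; rewrite uv in hu *.
by congr FuzzyNumber; exact: Prop_irrelevance.
Qed.

Lemma level_pos u r : 0 < r -> level u r = [set x | r <= u x].
Proof. by move=> r0; rewrite /level gt_eqF. Qed.

Lemma levelS u r s : 0 <= r -> r <= s -> level u s `<=` level u r.
Proof.
rewrite le_eqVlt => /predU1P[<-|r0] rs.
  move: rs; rewrite le_eqVlt => /predU1P[<-//|s0].
  rewrite level_pos// /level eqxx => x /= sx; apply: subset_closure => /=.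
  exact: lt_le_trans sx.
rewrite !level_pos//; last exact: lt_le_trans rs.
by move=> x /=; exact: le_trans.
Qed.

Lemma level_bounded u : is_fuzzy_number u ->
  exists M, forall r, 0 <= r -> level u r `<=` `[- M, M].
Proof.
move=> [_ _ _ _ /compact_bounded[M [_ hM]]]; exists (M + 1) => r r0 x.
move=> /(levelS (lexx 0) r0); rewrite /level eqxx => /(hM (M + 1) _).
by rewrite /= in_itv/= -ler_norml; apply; rewrite ltrDl.
Qed.

Lemma level_closed u r : is_fuzzy_number u -> 0 <= r -> closed (level u r).
Proof.
move=> hu; rewrite le_eqVlt => /predU1P[<-|r0].
  by rewrite /level eqxx; exact: closed_closure.
rewrite level_pos// (_ : [set _ | _] = ~` [set x | u x < r]); last first.
  by apply/seteqP; split => x /=; rewrite leNgt => /negP.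
by apply: open_closedC; rewrite openE => x; exact: (fuzzy_usc hu).
Qed.

Lemma level_neq0 u r : is_fuzzy_number u -> r <= 1 -> level u r !=set0.
Proof.
move=> hu r1; have [x ux] := fuzzy_normal hu; exists x.
rewrite /level; case: ifPn => _; last by rewrite /= ux.
by apply: subset_closure; rewrite /= ux.
Qed.

Lemma quasiconcave_itv u (A : set R) : is_fuzzy_number u ->
  (forall x y z, A x -> A y -> Num.min (u x) (u y) <= u z -> A z) ->
  is_interval A.
Proof.
move=> hu hA x y Ax Ay z /andP[xz zy]; apply: (hA x y z) => //.
have [xy|xy] := eqVneq x y.
  have -> : z = x by apply/eqP; rewrite eq_le xz xy zy.
  by rewrite ge_min lexx.
have xy0 : 0 < y - x by rewrite subr_gt0 lt_neqAle xy (le_trans xz).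
pose t := (y - z) / (y - x).
have -> : z = t * x + (1 - t) * y.
  have tE : t * (y - x) = y - z by rewrite /t mulfVK// gt_eqF.
  have -> : t * x + (1 - t) * y = y - t * (y - x) by ring.
  by rewrite tE; ring.
apply: (fuzzy_quasiconcave hu); apply/andP; split.
  by rewrite divr_ge0 ?subr_ge0// (le_trans xz).
by rewrite ler_pdivrMr// mul1r lerB.
Qed.

Lemma level_interval u r : is_fuzzy_number u -> 0 <= r -> is_interval (level u r).
Proof.
move=> hu; rewrite le_eqVlt => /predU1P[<-|r0].
  rewrite /level eqxx; apply/connected_intervalP/connected_closure.
  apply/connected_intervalP/(quasiconcave_itv hu) => x y z /= x0 y0.
  by apply: lt_le_trans; rewrite lt_min x0 y0.
rewrite level_pos//; apply: (quasiconcave_itv hu) => x y z /= rx ry.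
by apply: le_trans; rewrite le_min rx ry.
Qed.

Lemma level_has_lbound u r : is_fuzzy_number u -> 0 <= r -> has_lbound (level u r).
Proof.
move=> hu r0; have [M hM] := level_bounded hu; exists (- M) => x /(hM _ r0).
by rewrite /= in_itv/= => /andP[].
Qed.

Lemma level_has_ubound u r : is_fuzzy_number u -> 0 <= r -> has_ubound (level u r).
Proof.
move=> hu r0; have [M hM] := level_bounded hu; exists M => x /(hM _ r0).
by rewrite /= in_itv/= => /andP[].
Qed.

Lemma level_sup u r : is_fuzzy_number u -> 0 <= r <= 1 -> level u r (sup (level u r)).
Proof.
move=> hu /andP[r0 r1]; apply: (level_closed hu r0).
by apply: closure_sup; [exact: level_neq0|exact: level_has_ubound].
Qed.

Lemma level_inf u r : is_fuzzy_number u -> 0 <= r <= 1 -> level u r (inf (level u r)).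
Proof.
move=> hu /andP[r0 r1]; apply: (level_closed hu r0) => B.
move=> /nbhs_ballP[e /= e0 eB].
have hi : has_inf (level u r).
  by split; [exact: level_neq0|exact: level_has_lbound].
have [x ux xe] := inf_adherent e0 hi; exists x; split=> //; apply: eB.
rewrite /ball/= distrC ger0_norm ?subr_ge0; first by rewrite ltrBlDl.
by apply: ge_inf => //; exact: level_has_lbound.
Qed.

Lemma levelE u r : is_fuzzy_number u -> 0 <= r <= 1 ->
  level u r = `[inf (level u r), sup (level u r)]%classic.
Proof.
move=> hu r01; have /andP[r0 r1] := r01; apply/seteqP; split => x /=.
  move=> ux; rewrite in_itv/= ge_inf ?ub_le_sup//.
    exact: level_has_ubound.
  exact: level_has_lbound.
rewrite in_itv/=; apply: level_interval => //; [exact: level_inf|exact: level_sup].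
Qed.

Lemma bounded_compact_support u M :
  (forall x, 0 < u x -> `|x| <= M) -> compact (closure [set x | 0 < u x]).
Proof.
move=> hM; apply: (@subclosed_compact _ _ `[- M, M]).
- exact: closed_closure.
- exact: segment_compact.
- rewrite -[X in _ `<=` X](_ : closure `[- M, M] = _).
    by apply: closure_subset => x /= /hM; rewrite in_itv/= ler_norml.
  by rewrite -(closure_id _).1//; exact: interval_closed.
Qed.

Lemma support_bounded u : is_fuzzy_number u ->
  exists M, forall x, 0 < u x -> `|x| <= M.
Proof.
move=> /level_bounded[M hM]; exists M => x x0.
have := hM 0 (lexx _) x; rewrite /level eqxx /= in_itv/= ler_norml; apply.
exact: subset_closure.
Qed.

Let sup_set u v x := [set m | exists y z, y + z = x /\ m = Num.min (u y) (v z)].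

Let sup_set_has_sup u v x : is_fuzzy_number u -> has_sup (sup_set u v x).
Proof.
move=> hu; split; first by exists (Num.min (u x) (v 0)), x, 0; rewrite addr0.
exists 1 => _ [y [z [_ ->]]]; rewrite ge_min.
by have /andP[_ ->] := fuzzy_range hu y.
Qed.

Let add_ub u v y z : is_fuzzy_number u ->
  Num.min (u y) (v z) <= fuzzy_add_fun u v (y + z).
Proof.
move=> hu; apply: ub_le_sup; last by exists y, z.
by have [] := sup_set_has_sup v (y + z) hu.
Qed.

Let add_lt u v x a : is_fuzzy_number u -> a < fuzzy_add_fun u v x ->
  exists y z, [/\ y + z = x, a < u y & a < v z].
Proof.
move=> hu /sup_gt[|_ [y [z [yz ->]]]].
  by have [] := sup_set_has_sup v x hu.
by rewrite lt_min => /andP[? ?]; exists y, z.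
Qed.

Lemma fuzzy_add_subproof u v : is_fuzzy_number u -> is_fuzzy_number v ->
  is_fuzzy_number (fuzzy_add_fun u v).
Proof.
move=> hu hv.
have w1 x : fuzzy_add_fun u v x <= 1.
  apply: ge_sup; first by have [] := sup_set_has_sup v x hu.
  move=> _ [y [z [_ ->]]]; rewrite ge_min.
  by have /andP[_ ->] := fuzzy_range hu y.
have w0 x : 0 <= fuzzy_add_fun u v x.
  apply: le_trans (_ : Num.min (u x) (v 0) <= _).
    have /andP[? _] := fuzzy_range hu x; have /andP[? _] := fuzzy_range hv 0.
    by rewrite le_min; apply/andP.
  by have := @add_ub u v x 0 hu; rewrite addr0.
split.
- by move=> x; rewrite w0 w1.
- have [x ux] := fuzzy_normal hu; have [y vy] := fuzzy_normal hv.
  exists (x + y); apply/eqP; rewrite eq_le w1/=.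
  by have := @add_ub u v x y hu; rewrite ux vy minxx.
- move=> t x y t01; rewrite leNgt; apply/negP.
  rewrite lt_min => /andP[/(add_lt hu)[x1 [x2 [xE ux vx]]]].
  move=> /(add_lt hu)[y1 [y2 [yE uy vy]]].
  move: ux vx uy vy; rewrite -xE -yE.
  have -> : t * (x1 + x2) + (1 - t) * (y1 + y2) =
      (t * x1 + (1 - t) * y1) + (t * x2 + (1 - t) * y2) by ring.
  move=> ux vx uy vy.
  have := @add_ub u v (t * x1 + (1 - t) * y1) (t * x2 + (1 - t) * y2) hu.
  rewrite leNgt => /negP; apply; rewrite lt_min; apply/andP; split.
    apply: lt_le_trans (fuzzy_quasiconcave hu _ _ t01).
    by rewrite lt_min ux uy.
  apply: lt_le_trans (fuzzy_quasiconcave hv _ _ t01).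
  by rewrite lt_min vx vy.
- move=> x a wxa.
  have [a1|a1] := ltP 1 a.
    by near=> y; exact: le_lt_trans a1.
  pose b := (fuzzy_add_fun u v x + a) / 2.
  have wb : fuzzy_add_fun u v x < b by rewrite midf_lt.
  have ba : b < a by rewrite midf_lt.
  have b01 : 0 <= b <= 1.
    by rewrite (le_trans (w0 x) (ltW wb))/= (le_trans (ltW ba)).
  have b0 : 0 < b by rewrite (le_lt_trans (w0 x)).
  have uE z : (b <= u z) =
      (inf (level u b) <= z <= sup (level u b)).
    have := congr1 (fun A => A z) (levelE hu b01).
    rewrite {1}level_pos//= in_itv/= => e.
    by apply/idP/idP; rewrite e.
  have vE z : (b <= v z) =
      (inf (level v b) <= z <= sup (level v b)).
    have := congr1 (fun A => A z) (levelE hv b01).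
    rewrite {1}level_pos//= in_itv/= => e.
    by apply/idP/idP; rewrite e.
  set p := inf (level u b) in uE; set q := sup (level u b) in uE.
  set p' := inf (level v b) in vE; set q' := sup (level v b) in vE.
  have pq : p <= q.
    have := level_inf hu b01; rewrite {1}levelE//= in_itv/=.
    by move=> /andP[].
  have pq' : p' <= q'.
    have := level_inf hv b01; rewrite {1}levelE//= in_itv/=.
    by move=> /andP[].
  have key y : y < p + p' \/ q + q' < y -> fuzzy_add_fun u v y < a.
    move=> hy; rewrite ltNge; apply/negP => /(lt_le_trans ba) /(add_lt hu).
    move=> [y1 [y2 [yE /ltW]]]; rewrite uE => /andP[py yq] /ltW.
    rewrite vE => /andP[py' yq']; case: hy; rewrite -yE ltNge => /negP; apply;
      exact: lerD.
  have [xp|px] := ltP x (p + p').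
    near=> y; apply: key; left; near: y; exact: lt_nbhsl.
  have [xq|qx] := ltP (q + q') x.
    near=> y; apply: key; right; near: y; exact: lt_nbhsr.
  exfalso; move: wb; rewrite ltNge => /negP; apply.
  pose y := Num.max p (x - q').
  apply: le_trans (_ : Num.min (u y) (v (x - y)) <= _); last first.
    by have := @add_ub u v y (x - y) hu; rewrite [y + _]addrC subrK.
  rewrite le_min uE vE /y.
  have [h|h] := leP p (x - q').
    by apply/andP; split; apply/andP; split; lra.
  by apply/andP; split; apply/andP; split; lra.
- have [M hM] := support_bounded hu; have [M' hM'] := support_bounded hv.
  apply: (@bounded_compact_support _ (M + M')) => x /(add_lt hu).
  move=> [y [z [<- /hM hy /hM' hz]]].
  exact: le_trans (ler_normD _ _) (lerD hy hz).
Unshelve. all: by end_near. Qed.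

Lemma fuzzy_scale_subproof l u : is_fuzzy_number u ->
  is_fuzzy_number (fuzzy_scale_fun l u).
Proof.
move=> hu; rewrite /fuzzy_scale_fun; case: eqVneq => [_|l0].
  split.
  - by move=> x; rewrite indicE; case: (_ \in _); rewrite ?lexx ?ler01.
  - by exists 0; rewrite indicE mem_set.
  - move=> t x y /andP[t0 t1]; rewrite !indicE.
    have [->|x0] := eqVneq x 0; have [->|y0] := eqVneq y 0.
    + by rewrite !mulr0 addr0 ge_min lexx.
    + by rewrite [y \in _]memNset ?ge_min ?ler0n ?orbT//; exact/eqP.
    + by rewrite [x \in _]memNset ?ge_min ?ler0n ?orbT//; exact/eqP.
    + by rewrite [x \in _]memNset ?ge_min ?ler0n ?orbT//; exact/eqP.
  - move=> x a; rewrite indicE.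
    have [->|x0] := eqVneq x 0.
      rewrite mem_set//= => a1; near=> y; rewrite indicE (le_lt_trans _ a1)//.
      by rewrite lern1 leq_b1.
    rewrite memNset/=; last exact/eqP.
    move=> a0.
    suff : \forall y \near x, y != 0.
      by apply: filterS => y y0; rewrite indicE memNset//; exact/eqP.
    apply: open_nbhs_nbhs; split => //; exact: open_neq.
  - apply: (@bounded_compact_support _ 0) => x.
    rewrite indicE; case: (boolP (x \in _)); last by rewrite ltxx.
    by rewrite inE/= => -> _; rewrite normr0.
have cl : continuous (fun x : R => x / l) by move=> x; exact: mulrr_continuous.
split.
- by move=> x; exact: fuzzy_range.
- have [x ux] := fuzzy_normal hu; exists (x * l); by rewrite mulfK.
- move=> t x y t01.
  rewrite mulrDl -!mulrA; exact: fuzzy_quasiconcave.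
- by move=> x a /(fuzzy_usc hu); exact: cl.
- have [M hM] := support_bounded hu.
  apply: (@bounded_compact_support _ (M * `|l|)) => x /hM.
  by rewrite normrM normfV ler_pdivrMr ?normr_gt0.
Unshelve. all: by end_near. Qed.

End level_sets.

Definition fuzzy_add (R : realType) (u v : fuzzy_number R) : fuzzy_number R :=
  FuzzyNumber (fuzzy_add_subproof (fuzzy_numberP u) (fuzzy_numberP v)).

Definition fuzzy_scale (R : realType) (l : R) (u : fuzzy_number R) :
    fuzzy_number R :=
  FuzzyNumber (fuzzy_scale_subproof l (fuzzy_numberP u)).

(* Functions on [0, 1] are functions on the subtype attached to this set, whose
   topology is the one induced by R. *)
Definition unitI (R : realType) : set R := `[0, 1]%classic.
Arguments unitI R : clear implicits.

Section Cbar_space.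
Context {R : realType}.

Definition at_leftI (r : unitI R) : set_system (unitI R) :=
  within (fun s : unitI R => val s < val r) (nbhs r).

Definition at_rightI (r : unitI R) : set_system (unitI R) :=
  within (fun s : unitI R => val r < val s) (nbhs r).

Record is_Cbar (f : unitI R -> R) : Prop := IsCbar {
  Cbar_bounded : exists M, forall r, `|f r| <= M;
  Cbar_left_continuous : forall r : unitI R, 0 < val r -> f @ at_leftI r --> f r;
  Cbar_right_limit : forall r : unitI R, val r < 1 -> cvg (f @ at_rightI r);
  Cbar_right_continuous0 : forall r : unitI R, val r = 0 -> f @ at_rightI r --> f r
}.

Definition Cbar_pred : {pred unitI R -> R} := mem [set f | is_Cbar f].

Lemma Cbar_submod_closed : submod_closed Cbar_pred.
Proof.
split.
  rewrite inE; split => [|r _|r _|r _]; last 3 first.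
  - exact: cvg_cst.
  - exact: is_cvg_cst.
  - exact: cvg_cst.
  - by exists 0 => r; rewrite normr0.
move=> a f g; rewrite !inE => -[[M fM] fl fr f0] [[N gN] gl gr g0].
split => [|r hr|r hr|r hr].
- exists (`|a| * M + N) => r; apply: le_trans (ler_normD _ _) _.
  by apply: lerD => //; rewrite normrM ler_wpM2l.
- by apply: cvgD; [apply: cvgMr; exact: fl|exact: gl].
- by apply: is_cvgD; [apply: is_cvgMr; exact: fr|exact: gr].
- by apply: cvgD; [apply: cvgMr; exact: f0|exact: g0].
Qed.

HB.instance Definition _ :=
  GRing.isSubmodClosed.Build _ _ Cbar_pred Cbar_submod_closed.

End Cbar_space.

Record Cbar (R : realType) : Type := MkCbar {
  Cbar_fun :> unitI R -> R;
  _ : Cbar_fun \in Cbar_pred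
}.

HB.instance Definition _ (R : realType) := [isSub for @Cbar_fun R].
HB.instance Definition _ (R : realType) := [Choice of Cbar R by <:].
HB.instance Definition _ (R : realType) := [SubChoice_isSubLmodule of Cbar R by <:].

Section Cbar_norm.
Context {R : realType}.
Implicit Types f g : Cbar R.

(* The norm of uniform convergence; it makes Cbar R a normed module, so that
   continuity on a subset of Cbar R is continuity for uniform convergence. *)
Definition Cbar_norm f : R := sup (range (fun r => `|f r|)).

Let unitI0 : unitI R.
Proof. by exists 0; rewrite inE /unitI/= in_itv/= lexx ler01. Defined.

Lemma CbarP f : is_Cbar f.
Proof. by have := valP f; rewrite inE. Qed.

Lemma Cbar_norm_has_sup f : has_sup (range (fun r => `|f r|)).
Proof.
split; first by exists `|f unitI0|, unitI0.
by have [M fM] := Cbar_bounded (CbarP f); exists M => _ [r _ <-].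
Qed.

Lemma Cbar_norm_ub f r : `|f r| <= Cbar_norm f.
Proof. by apply: ub_le_sup; [have [] := Cbar_norm_has_sup f|exists r]. Qed.

Lemma Cbar_norm_le f M : (forall r, `|f r| <= M) -> Cbar_norm f <= M.
Proof.
by move=> fM; apply: ge_sup; [have [] := Cbar_norm_has_sup f|move=> _ [r _ <-]].
Qed.

Lemma Cbar_normD f g : Cbar_norm (f + g) <= Cbar_norm f + Cbar_norm g.
Proof.
apply: Cbar_norm_le => r; apply: le_trans (ler_normD _ _) _.
by apply: lerD; exact: Cbar_norm_ub.
Qed.

Lemma Cbar_normZ (a : R) f : Cbar_norm (a *: f) = `|a| * Cbar_norm f.
Proof.
have le (b : R) h : Cbar_norm (b *: h) <= `|b| * Cbar_norm h.
  apply: Cbar_norm_le => r; rewrite [X in `|X|](_ : _ = b * h r)// normrM.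
  by rewrite ler_wpM2l//; exact: Cbar_norm_ub.
apply/eqP; rewrite eq_le le /=.
have [->|a0] := eqVneq a 0.
  rewrite normr0 mul0r; apply: le_trans (Cbar_norm_ub _ unitI0).
  exact: normr_ge0.
have := le a^-1 (a *: f); rewrite scalerA mulVf// scale1r normfV.
by rewrite ler_pdivlMl// normr_gt0.
Qed.

Lemma Cbar_norm0_eq0 f : Cbar_norm f = 0 -> f = 0.
Proof.
move=> f0; apply/val_inj/funext => r; apply/eqP; rewrite -normr_le0 -f0.
exact: Cbar_norm_ub.
Qed.

HB.instance Definition _ :=
  Lmodule_isNormed.Build R (Cbar R) Cbar_normD Cbar_normZ Cbar_norm0_eq0.

Lemma Cbar_normE f : `|f| = Cbar_norm f.
Proof. by []. Qed.

End Cbar_norm.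

Definition IC (R : realType) : set (Cbar R) :=
  [set f | forall r s : unitI R, val r <= val s -> f r <= f s].

Section endpoints.
Context {R : realType}.
Implicit Types (u v : fuzzy_number R) (r s : unitI R).

(* The functions u_- and u_+ giving the endpoints of the level sets of u,
   see level_itvE; lower u and upper u below are these functions as elements
   of Cbar R. *)
Definition lower_fun u r : R := inf (level u (val r)).
Definition upper_fun u r : R := sup (level u (val r)).

Lemma unitI01 r : 0 <= val r <= 1.
Proof. by have := valP r; rewrite inE /unitI/= in_itv. Qed.

Lemma level_itvE u r :
  level u (val r) = `[lower_fun u r, upper_fun u r]%classic.
Proof. exact: levelE (fuzzy_numberP u) (unitI01 r). Qed.

Lemma lower_upper u r : lower_fun u r <= upper_fun u r.
Proof.
have := level_inf (fuzzy_numberP u) (unitI01 r).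
by rewrite {1}level_itvE/= in_itv/= => /andP[].
Qed.

Lemma lower_fun_homo u r s : val r <= val s -> lower_fun u r <= lower_fun u s.
Proof.
move=> rs; have /andP[r0 _] := unitI01 r.
have := levelS (u := u) r0 rs; rewrite !level_itvE => /(_ (lower_fun u s)).
by rewrite /= !in_itv/= lexx lower_upper => /(_ isT)/andP[].
Qed.

Lemma near_unitI r (e : R) : 0 < e -> \forall s \near r, `|val r - val s| < e.
Proof.
move=> e0.
have : continuous (val : unitI R -> R) by exact: initial_continuous.
by move=> /(_ r) /cvgrPdist_lt/(_ e e0).
Qed.

Lemma lower_is_Cbar u : is_Cbar (lower_fun u).
Proof.
have hu := fuzzy_numberP u.
split.
- have [M hM] := level_bounded hu; exists M => r.
  have /andP[r0 _] := unitI01 r; have := hM _ r0 _ (level_inf hu (unitI01 r)).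
  by rewrite /= in_itv/= ler_norml.
- move=> r r0; apply/cvgrPdist_lt => e e0.
  pose x := lower_fun u r - e.
  have xr : u x < val r.
    have : ~ level u (val r) x.
      by rewrite level_itvE/= in_itv/= => /andP[+ _]; rewrite /x; lra.
    by rewrite level_pos//= => /negP; rewrite -ltNge.
  have : \forall s \near r, `|val r - val s| < val r - u x.
    by apply: near_unitI; rewrite subr_gt0.
  rewrite /at_leftI near_withinE; apply: filterS => s rs sr.
  have us : u x < val s by move: rs; rewrite ltr_norml; lra.
  have s0 : 0 < val s.
    by apply: le_lt_trans us; have /andP[] := fuzzy_range hu x.
  have Lsr := lower_fun_homo u (ltW sr).
  have : ~ level u (val s) x by rewrite level_pos//= leNgt us.
  rewrite level_itvE/= in_itv/= => /negP; rewrite negb_and -!ltNge.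
  have := lower_upper u s; have := lower_upper u r.
  have : x < lower_fun u r by rewrite /x; lra.
  have Usr : upper_fun u r <= upper_fun u s.
    have := level_sup hu (unitI01 r).
    have := levelS (u := u) (ltW s0) (ltW sr) => /[apply].
    by rewrite -/(upper_fun u r) level_itvE/= in_itv/= => /andP[].
  rewrite ltr_norml; move=> ? ? ? /orP[]; rewrite /x; lra.
- move=> r r1.
  pose A := [set lower_fun u s | s in [set s | val r < val s]].
  have A0 : has_inf A.
    split.
      have I1 : (1 : R) \in unitI R by rewrite inE /unitI/= in_itv/= ler01 lexx.
      by exists (lower_fun u (exist _ 1 I1)), (exist _ 1 I1).
    by exists (lower_fun u r) => _ [s rs <-]; apply: lower_fun_homo; exact: ltW.
  apply/cvg_ex; exists (inf A); apply/cvgrPdist_lt => e e0.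
  have [_ [s rs <-] se] := inf_adherent e0 A0.
  have : \forall t \near r, `|val r - val t| < val s - val r.
    by apply: near_unitI; rewrite subr_gt0.
  rewrite /at_rightI near_withinE; apply: filterS => t ht rt.
  have ts : val t <= val s by move: ht; rewrite ltr_norml; lra.
  have Lts := lower_fun_homo u ts.
  have At : inf A <= lower_fun u t by apply: ge_inf; [exact: (A0.2)|exists t].
  by rewrite ltr_norml; lra.
- move=> r r0; apply/cvgrPdist_lt => e e0.
  have := level_inf hu (unitI01 r); rewrite r0 {1}/level eqxx.
  move=> /(_ (ball (inf (level u 0)) e)) [|y /= [y0]].
    exact: nbhsx_ballx.
  rewrite /ball/= ltr_norml -[X in inf (level _ X)]r0 -/(lower_fun u r) => ye.
  have : \forall t \near r, `|val r - val t| < u y by exact: near_unitI.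
  rewrite /at_rightI near_withinE; apply: filterS => t ht rt.
  have ty : level u (val t) y.
    suff h : val t <= u y by rewrite level_pos; [exact: h|rewrite -r0].
    by move: ht; rewrite ltr_norml r0; lra.
  move: ty; rewrite level_itvE/= in_itv/= => /andP[ty _].
  have Lrt := lower_fun_homo u (ltW rt).
  by rewrite ltr_norml; lra.
Qed.

Lemma level_scaleN1 u (r : R) :
  level (fuzzy_scale (-1) u) r = -%R @` level u r.
Proof.
have suE x : fuzzy_scale (-1) u x = u (- x).
  by rewrite /= /fuzzy_scale_fun oppr_eq0 oner_eq0 invrN1 mulrN1.
move: (fuzzy_fun (fuzzy_scale (-1) u)) suE => w suE.
rewrite /level; case: ifPn => _; apply/seteqP; split => x.
- move=> cx; exists (- x); last by rewrite opprK.
  move=> B /(@oppr_continuous _ _ x)/cx [y /= [y0 By]].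
  by exists (- y); split => //=; rewrite -suE.
- move=> [y cy <-] B /(@oppr_continuous _ _ y)/cy [z /= [z0 Bz]].
  by exists (- z); split => //=; rewrite suE opprK.
- by rewrite /= suE => rx; exists (- x) => //; rewrite opprK.
- by move=> [y /= ry <-]; rewrite suE opprK.
Qed.

Lemma upper_funE u : upper_fun u = - lower_fun (fuzzy_scale (-1) u).
Proof.
apply/funext => r; rewrite [RHS](_ : _ = - lower_fun (fuzzy_scale (-1) u) r)//.
rewrite /upper_fun /lower_fun level_scaleN1 /inf opprK image_comp.
rewrite (_ : -%R \o -%R = id) ?image_id//.
by apply/funext => x /=; rewrite opprK.
Qed.

Lemma lower_in_Cbar u : lower_fun u \in Cbar_pred.
Proof. by rewrite inE; exact: lower_is_Cbar. Qed.

Lemma upper_in_Cbar u : upper_fun u \in Cbar_pred.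
Proof. by rewrite upper_funE rpredN; exact: lower_in_Cbar. Qed.

Definition lower u : Cbar R := MkCbar (lower_in_Cbar u).
Definition upper u : Cbar R := MkCbar (upper_in_Cbar u).

(* The metric D; it makes fuzzy_number R a metric space below. *)
Definition fuzzy_dist u v : R :=
  sup (range (fun r => Num.max `|lower u r - lower v r|
                               `|upper u r - upper v r|)).

Let unitI0 : unitI R.
Proof. by exists 0; rewrite inE /unitI/= in_itv/= lexx ler01. Defined.

Lemma fuzzy_dist_has_sup u v :
  has_sup (range (fun r => Num.max `|lower u r - lower v r|
                                   `|upper u r - upper v r|)).
Proof.
split; first by eexists; exists unitI0.
exists (Num.max (Cbar_norm (lower u - lower v)) (Cbar_norm (upper u - upper v))).
move=> _ [r _ <-]; rewrite ge_max !le_max.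
by rewrite (Cbar_norm_ub (lower u - lower v) r)
  (Cbar_norm_ub (upper u - upper v) r) orbT.
Qed.

Lemma fuzzy_dist_ub u v r :
  Num.max `|lower u r - lower v r| `|upper u r - upper v r| <= fuzzy_dist u v.
Proof.
by apply: ub_le_sup; [have [] := fuzzy_dist_has_sup u v|exists r].
Qed.

Lemma fuzzy_distxx u : fuzzy_dist u u = 0.
Proof.
apply/eqP; rewrite eq_le; apply/andP; split.
  apply: ge_sup; first by have [] := fuzzy_dist_has_sup u u.
  by move=> _ [r _ <-]; rewrite !subrr normr0 maxxx.
by have := fuzzy_dist_ub u u unitI0; rewrite !subrr normr0 maxxx.
Qed.

Lemma fuzzy_number_level_eq u v :
  (forall r : unitI R, level u (val r) = level v (val r)) -> u = v.
Proof.
move=> uv; apply: fuzzy_number_eq => x.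
have le (w z : fuzzy_number R) :
    (forall r : unitI R, level w (val r) = level z (val r)) -> w x <= z x.
  move=> wz; have w01 := fuzzy_range (fuzzy_numberP w) x.
  have /andP[z0 _] := fuzzy_range (fuzzy_numberP z) x.
  have [w0|w0] := leP (w x) 0; first exact: le_trans z0.
  have wI : w x \in unitI R by rewrite inE /unitI/= in_itv.
  have /= := congr1 (fun A => A x) (wz (exist _ (w x) wI)).
  by rewrite !level_pos//= => <-.
by apply/eqP; rewrite eq_le !le.
Qed.

Lemma fuzzy_dist_eq0 u v : fuzzy_dist u v = 0 -> u = v.
Proof.
move=> uv0; apply: fuzzy_number_level_eq => r; rewrite !level_itvE.
have := fuzzy_dist_ub u v r; rewrite uv0 ge_max !normr_le0 !subr_eq0.
by move=> /andP[/eqP/= -> /eqP/= ->].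
Qed.

Lemma fuzzy_dist_sym u v : fuzzy_dist u v = fuzzy_dist v u.
Proof.
congr sup; apply: eq_imagel => r _.
by rewrite distrC [X in Num.max _ X]distrC.
Qed.

Lemma fuzzy_dist_triangle v u w :
  fuzzy_dist u w <= fuzzy_dist u v + fuzzy_dist v w.
Proof.
apply: ge_sup; first by have [] := fuzzy_dist_has_sup u w.
move=> _ [r _ <-]; have := fuzzy_dist_ub u v r; have := fuzzy_dist_ub v w r.
rewrite !ge_max => /andP[vl vu] /andP[ul uu]; apply/andP; split.
  by apply: le_trans (ler_distD (lower v r) _ _) _; exact: lerD.
by apply: le_trans (ler_distD (upper v r) _ _) _; exact: lerD.
Qed.

HB.instance Definition _ := isMetric.Build R (fuzzy_number R)
  fuzzy_distxx fuzzy_dist_eq0 fuzzy_dist_sym fuzzy_dist_triangle.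

Lemma fuzzy_mdistE u v : mdist u v = fuzzy_dist u v.
Proof. by []. Qed.

End endpoints.

Definition fuzzy_linear (R : realType) (A : fuzzy_number R -> R) : Prop :=
  (forall x y, A (fuzzy_add x y) = A x + A y) /\
  (forall (l : R) x, A (fuzzy_scale l x) = l * A x).

(* Main.v *)
(* A linear functional A vanishes at every fuzzy number z with z_- + z_+ = 0, as
   such a z equals (-1) z; hence A x depends only on x_- + x_+. These sums form
   a linear subspace of Cbar, which has an algebraic complement, so L is A
   composed with a linear projection onto that subspace. A nondecreasing f is
   such a sum: it comes from the fuzzy number with endpoints f - f(1)/2 and
   f(1)/2, which depends on f in a Lipschitz way, so L is continuous on IC.
   Conversely A x = L(x_-) - L(- x_+), where both arguments lie in IC. *)

From HB Require Import structures.
Require Import Defs.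
From mathcomp Require Import all_boot all_order all_algebra.
From mathcomp Require Import all_classical all_reals all_analysis.
From mathcomp Require Import ring lra.
Import Order.TTheory GRing.Theory Num.Theory.
Import numFieldNormedType.Exports.
Local Open Scope classical_set_scope.
Local Open Scope ring_scope.

(** * Approximation of functions in [Cbar] at points of [0, 1] *)

Lemma nbhs_unitI (R : realType) (r : unitI R) (P : set (unitI R)) : nbhs r P ->
  exists2 d : R, 0 < d & forall s : unitI R, `|val r - val s| < d -> P s.
Proof.
move=> [B [[U oU UB] Br] BP].
have Ur : U (val r) by move: Br; rewrite -UB.
move: oU; rewrite openE => /(_ _ Ur)/nbhs_ballP[d /= d0 dU]; exists d => // s rs.
by apply: BP; rewrite -UB; exact: dU.
Qed.

Lemma Cbar_approx_left {R : realType} (f : Cbar R) (r : unitI R) (e : R) :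
  0 < val r -> 0 < e ->
  exists s : unitI R, [/\ 0 < val s, val s < val r & `|f r - f s| < e].
Proof.
move=> r0 e0.
have /cvgrPdist_lt/(_ e e0) := Cbar_left_continuous (CbarP f) r0.
rewrite /at_leftI near_withinE => /nbhs_unitI[d d0 hd].
(* The maximum keeps [t] both positive and within [d] of [val r]. *)
pose t := Num.max (val r / 2) (val r - d / 2).
have /andP[_ r1] := unitI01 r.
have [t0 tr td] : [/\ 0 < t, t < val r & val r - t < d].
  by rewrite /t; move: (val r) r0 => q q0; case: (leP (q / 2)) => h; split; lra.
have t1 : t \in unitI R.
  by rewrite inE /unitI/= in_itv/= (ltW t0)/= (le_trans (ltW tr)).
exists (exist _ t t1); split => //.
by apply: hd => //; rewrite /= gtr0_norm ?subr_gt0.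
Qed.

Lemma Cbar_approx_right0 {R : realType} (f : Cbar R) (r : unitI R) (e : R) :
  val r = 0 -> 0 < e ->
  exists2 d, 0 < d & forall s : unitI R, 0 < val s < d -> `|f r - f s| < e.
Proof.
move=> r0 e0.
have /cvgrPdist_lt/(_ e e0) := Cbar_right_continuous0 (CbarP f) r0.
rewrite /at_rightI near_withinE => /nbhs_unitI[d d0 hd].
exists d => // s /andP[s0 sd]; apply: hd; rewrite r0//.
by rewrite sub0r normrN gtr0_norm.
Qed.

(** Right continuity at 0 determines the value there. Endpoint functions can thus be compared at
    positive levels only, avoiding the closure that defines level 0. *)
Lemma eq_Cbar_pos {R : realType} (f g : Cbar R) :
  (forall r : unitI R, 0 < val r -> f r = g r) -> f = g.
Proof.
move=> fg; apply/val_inj/funext => r.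
have [/fg//|] := ltP 0 (val r); have /andP[+ _] := unitI01 r.
move=> r0 r0'; have {r0'}r0 : val r = 0 by apply/eqP; rewrite eq_le r0 r0'.
apply/eqP; rewrite -subr_eq0 -normr_le0; apply/ler_addgt0Pl => e e0.
rewrite addr0.
have e2 : 0 < e / 2 by rewrite divr_gt0.
have [d d0 hf] := Cbar_approx_right0 f r _ r0 e2.
have [d' d0' hg] := Cbar_approx_right0 g r _ r0 e2.
pose t := Num.min 1 (Num.min d d' / 2).
have [t0 t1 td] : [/\ 0 < t, t <= 1 & t < Num.min d d'].
  have : 0 < Num.min d d' by rewrite lt_min d0.
  by rewrite /t; move: (Num.min d d') => m; case: (leP 1) => h; split; lra.
have tI : t \in unitI R by rewrite inE /unitI/= in_itv/= (ltW t0).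
move: td; rewrite lt_min => /andP[td td'].
have := hf (exist _ t tI); have := hg (exist _ t tI); rewrite /= t0 td td'.
move=> /(_ isT) + /(_ isT); rewrite (fg (exist _ t tI))// => h1 h2.
have -> : f r - g r = (f r - g (exist _ t tI)) - (g r - g (exist _ t tI)).
  by ring.
apply: le_trans (ler_normB _ _) _.
by rewrite (splitr e) ltW// ltrD.
Qed.

(** * Endpoint functions under the fuzzy operations *)

Section level_arith.
Context {R : realType}.
Implicit Types (u v : fuzzy_number R) (r s : unitI R).

Lemma level_lower u r : level u (val r) (lower u r).
Proof. exact: level_inf (fuzzy_numberP u) (unitI01 r). Qed.

Lemma lower_le u r (a : R) : 0 < val r -> val r <= u a -> lower u r <= a.
Proof.
move=> r0 ra; have : level u (val r) a by rewrite level_pos.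
by rewrite level_itvE/= in_itv/= => /andP[].
Qed.

Lemma le_fuzzy_lower u r : 0 < val r -> val r <= u (lower u r).
Proof. by move=> r0; have := level_lower u r; rewrite level_pos. Qed.

Lemma fuzzy_add_ge u v (a b : R) :
  Num.min (u a) (v b) <= fuzzy_add u v (a + b).
Proof.
apply: ub_le_sup; last by exists a, b.
exists 1 => _ [y [z [_ ->]]]; rewrite ge_min.
by have /andP[_ ->] := fuzzy_range (fuzzy_numberP u) y.
Qed.

Lemma fuzzy_add_gt u v (a c : R) : c < fuzzy_add u v a ->
  exists y z, [/\ y + z = a, c < u y & c < v z].
Proof.
move=> /sup_gt[|_ [y [z [yz ->]]]].
  by exists (Num.min (u a) (v 0)), a, 0; rewrite addr0.
by rewrite lt_min => /andP[? ?]; exists y, z.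
Qed.

Lemma lower_add u v : lower (fuzzy_add u v) = lower u + lower v.
Proof.
apply: eq_Cbar_pos => r r0; apply/eqP; rewrite eq_le; apply/andP; split.
  apply: lower_le => //; apply: le_trans (fuzzy_add_ge _ _ _ _).
  by rewrite le_min !le_fuzzy_lower.
apply/ler_addgt0Pl => e e0.
(* Attainment of the supremum defining the sum is avoided: a splitting is taken at a level [s] below
   [r], and left continuity bridges the gap. *)
have [s [s0 sr]] := Cbar_approx_left (lower u + lower v) r e r0 e0.
rewrite ltr_norml => /andP[_ hs].
have : val s < fuzzy_add u v (lower (fuzzy_add u v) r).
  exact: lt_le_trans (le_fuzzy_lower _ _ r0).
move=> /fuzzy_add_gt[y [z [<- /ltW uy /ltW vz]]].
have := lower_le _ _ _ s0 uy; have := lower_le _ _ _ s0 vz.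
have addE t : (lower u + lower v) t = lower u t + lower v t by [].
by move: hs; rewrite !addE; lra.
Qed.

Lemma fuzzy_scaleE (l : R) u (a : R) : l != 0 -> fuzzy_scale l u a = u (a / l).
Proof. by rewrite /= /fuzzy_scale_fun => /negPf ->. Qed.

Lemma fuzzy_scaleNE u (a : R) : fuzzy_scale (-1) u a = u (- a).
Proof. by rewrite fuzzy_scaleE ?oppr_eq0 ?oner_eq0// invrN1 mulrN1. Qed.

Lemma fuzzy_scaleNK u : fuzzy_scale (-1) (fuzzy_scale (-1) u) = u.
Proof. by apply: fuzzy_number_eq => a; rewrite !fuzzy_scaleNE opprK. Qed.

Lemma fuzzy_scaleN_add u v : fuzzy_scale (-1) (fuzzy_add u v) =
  fuzzy_add (fuzzy_scale (-1) u) (fuzzy_scale (-1) v).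
Proof.
apply: fuzzy_number_eq => a; rewrite fuzzy_scaleNE; congr sup.
apply/seteqP; split => _ [y [z [yz ->]]]; exists (- y), (- z).
  by rewrite !fuzzy_scaleNE !opprK -opprD yz opprK.
by rewrite -opprD yz !fuzzy_scaleNE.
Qed.

(** Reflection swaps and negates the endpoints, so facts about [upper] reduce to facts about
    [lower]. *)
Lemma upperE u : upper u = - lower (fuzzy_scale (-1) u).
Proof. by apply: val_inj; exact: upper_funE. Qed.

Lemma lowerN u : lower (fuzzy_scale (-1) u) = - upper u.
Proof. by rewrite upperE opprK. Qed.

Lemma upperN u : upper (fuzzy_scale (-1) u) = - lower u.
Proof. by rewrite upperE fuzzy_scaleNK. Qed.

Lemma upper_add u v : upper (fuzzy_add u v) = upper u + upper v.
Proof. by rewrite !upperE fuzzy_scaleN_add lower_add opprD. Qed.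

Lemma lower_scale_gt0 (l : R) u : 0 < l -> lower (fuzzy_scale l u) = l *: lower u.
Proof.
move=> l0; have ln0 := lt0r_neq0 l0; apply: eq_Cbar_pos => r r0.
rewrite [RHS](_ : _ = l * lower u r)//.
apply/eqP; rewrite eq_le; apply/andP; split.
  apply: lower_le => //; rewrite fuzzy_scaleE// mulrAC mulfV// mul1r.
  exact: le_fuzzy_lower.
rewrite mulrC -ler_pdivlMr//; apply: lower_le => //; rewrite -fuzzy_scaleE//.
exact: le_fuzzy_lower.
Qed.

Lemma lower_scale0 u : lower (fuzzy_scale 0 u) = 0.
Proof.
apply: eq_Cbar_pos => r r0; rewrite [RHS](_ : _ = 0)//.
have := le_fuzzy_lower (fuzzy_scale 0 u) r r0.
set a := lower _ _; rewrite [fuzzy_scale _ _ _](_ : _ = \1_[set 0] a); last first.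
  by rewrite /= /fuzzy_scale_fun eqxx.
rewrite indicE; case: (boolP (_ \in _)); first by rewrite inE.
by move=> _ /=; rewrite leNgt r0.
Qed.

Lemma fuzzy_scaleN_scale (l : R) u :
  fuzzy_scale (-1) (fuzzy_scale l u) = fuzzy_scale l (fuzzy_scale (-1) u).
Proof.
apply: fuzzy_number_eq => a; rewrite fuzzy_scaleNE.
have [->|l0] := eqVneq l 0.
  rewrite /= /fuzzy_scale_fun eqxx !indicE; congr (_%:R); congr nat_of_bool.
  apply/idP/idP; rewrite !inE/= => a0.
    by rewrite -[a]opprK a0 oppr0.
  by rewrite a0 oppr0.
by rewrite !(fuzzy_scaleE l)// fuzzy_scaleNE mulNr.
Qed.

Lemma fuzzy_scale_opp (l : R) u :
  fuzzy_scale (- l) u = fuzzy_scale l (fuzzy_scale (-1) u).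
Proof.
apply: fuzzy_number_eq => a; have [->|l0] := eqVneq l 0.
  by rewrite oppr0 /= /fuzzy_scale_fun eqxx.
by rewrite (fuzzy_scaleE (- l)) ?oppr_eq0// (fuzzy_scaleE l)// fuzzy_scaleNE invrN mulrN.
Qed.

(** Twice the midpoint of each level interval. The swap of endpoints under a negative scalar leaves
    it unaffected, so it respects all scalars. *)
Definition midsum u : Cbar R := lower u + upper u.

Lemma midsum_add u v : midsum (fuzzy_add u v) = midsum u + midsum v.
Proof. by rewrite /midsum lower_add upper_add addrACA. Qed.

Lemma midsum_scaleN u : midsum (fuzzy_scale (-1) u) = - midsum u.
Proof. by rewrite /midsum lowerN upperN opprD addrC. Qed.

Lemma midsum_scale (l : R) u : midsum (fuzzy_scale l u) = l *: midsum u.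
Proof.
have ge0 (k : R) v : 0 <= k -> midsum (fuzzy_scale k v) = k *: midsum v.
  rewrite le_eqVlt => /predU1P[<-|k0]; rewrite /midsum upperE fuzzy_scaleN_scale.
    by rewrite !lower_scale0 subr0 scale0r.
  by rewrite !(lower_scale_gt0 k)// lowerN scalerN opprK scalerDr.
have [/ge0//|l0] := leP 0 l.
rewrite -[l]opprK fuzzy_scale_opp ge0 ?oppr_ge0; last exact: ltW.
by rewrite midsum_scaleN scalerN !scaleNr.
Qed.

Lemma eq_lower_upper u v : lower u = lower v -> upper u = upper v -> u = v.
Proof.
move=> luv uuv; apply: fuzzy_number_level_eq => r; rewrite !level_itvE.
have -> : lower_fun u = lower_fun v by exact: (congr1 val luv).
by have -> : upper_fun u = upper_fun v by exact: (congr1 val uuv).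
Qed.

(** The difference [z] need not be the zero fuzzy number even when [u = v], but its levels are
    symmetric about 0, so it is its own reflection and [A z = - A z]. *)
Lemma fuzzy_linear_midsum (A : fuzzy_number R -> R) u v : fuzzy_linear A ->
  midsum u = midsum v -> A u = A v.
Proof.
move=> [AD AZ] uv; pose z := fuzzy_add u (fuzzy_scale (-1) v).
have sz : lower z = - upper z.
  apply/eqP; rewrite -addr_eq0 -/(midsum z) midsum_add midsum_scaleN uv.
  by rewrite subrr.
have zN : fuzzy_scale (-1) z = z.
  by apply: eq_lower_upper; rewrite ?lowerN ?upperN sz ?opprK.
have : A z = 0 by have := AZ (-1) z; rewrite zN; lra.
by rewrite AD AZ; lra.
Qed.

End level_arith.

(** * Projection onto a subspace of a vector space *)

(** Zorn's lemma gives [W] maximal among the subspaces meeting [S] only in 0. It is a complement of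
    [S], and [P] projects along it. *)
Lemma linear_projection (K : fieldType) (V : lmodType K) (S : set V) :
  S !=set0 -> (forall (k : K) x y, S x -> S y -> S (k *: x + y)) ->
  exists P : {linear V -> V}, (forall v, S (P v)) /\ (forall v, S v -> P v = v).
Proof.
move=> [s0 Ss0] linS.
have closed0 (W : set V) w : W w ->
    (forall (k : K) x y, W x -> W y -> W (k *: x + y)) -> W 0.
  by move=> Ww /(_ (-1) _ _ Ww Ww); rewrite scaleN1r addNr.
have S0 := closed0 _ _ Ss0 linS.
(* Stated so that [set0] qualifies, as the empty chain of Zorn_bigcup requires. *)
pose disjoint_subspace (W : set V) :=
  (forall (k : K) x y, W x -> W y -> W (k *: x + y)) /\
  (forall x, S x -> W x -> x = 0).
have [W [[linW SW] maxW]] : exists W, disjoint_subspace W /\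
    forall B, W `<` B -> ~ disjoint_subspace B.
  apply: Zorn_bigcup => F FP totF; split.
    move=> k x y [X FX Xx] [Y FY Yy]; have [XY|YX] := totF _ _ FX FY.
      by exists Y => //; apply: (FP _ FY).1 => //; exact: XY.
    by exists X => //; apply: (FP _ FX).1 => //; exact: YX.
  by move=> x Sx [X FX Xx]; exact: (FP _ FX).2.
have W0 : W 0.
  (* Maximality excludes the empty set, which lies strictly below [[set 0]]. *)
  have [Wn|/set0P[w Ww]] := eqVneq W set0; last exact: (closed0 _ _ Ww).
  exfalso; apply: (maxW [set 0]).
    by rewrite Wn; split => // /(_ 0 erefl).
  by split => [k x y -> ->|x _ ->//]; rewrite /= scaler0 addr0.
have scW (k : K) w : W w -> W (k *: w).
  by move=> Ww; rewrite -[_ *: _]addr0; exact: linW.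
have scS (k : K) s : S s -> S (k *: s).
  by move=> Ss; rewrite -[_ *: _]addr0; exact: linS.
have dec v : exists s, S s /\ W (v - s).
  apply/not_existsP => hv.
  (* If [v] were outside [S + W], adjoining it to [W] would give a larger subspace still meeting [S]
     only in 0. *)
  pose B := [set kw : V | exists (k : K) w, W w /\ kw = k *: v + w].
  apply: (maxW B).
    split; first by move=> w Ww; exists 0, w; rewrite scale0r add0r.
    have Bv : B v by exists 1, 0; rewrite scale1r addr0.
    by move=> /(_ v Bv) Wv; apply: (hv 0); rewrite subr0.
  split.
    move=> k x y [a [w [Ww ->]]] [b [w' [Ww' ->]]].
    exists (k * a + b), (k *: w + w'); split; first exact: linW.
    by rewrite scalerDr scalerDl scalerA addrACA.
  move=> x Sx [k [w [Ww xE]]].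
  have [k0|k0] := eqVneq k 0.
    by apply: SW => //; rewrite xE k0 scale0r add0r.
  (* Dividing [x = k *: v + w] by [k] exhibits an [S]-component of [v]. *)
  exfalso; apply: (hv (k^-1 *: x)); split; first exact: scS.
  rewrite xE scalerDr scalerA mulVf// scale1r opprD addNKr -scaleNr.
  exact: scW.
have [p pP] := choice dec.
(* Two [S]-components of [v] differ by an element of both [S] and [W]. This uniqueness makes the
   choice function [p] linear. *)
have p_uniq v s : S s -> W (v - s) -> p v = s.
  move=> Ss Ws; apply/eqP; rewrite -subr_eq0; apply/eqP; apply: SW.
    rewrite addrC -scaleN1r; apply: linS => //.
    by have [] := pP v.
  have -> : p v - s = (-1) *: (v - p v) + (v - s).
    by rewrite scaleN1r opprB addrA subrK.
  by apply: linW => //; have [] := pP v.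
have linp : linear p.
  move=> k x y; have [Sx Wx] := pP x; have [Sy Wy] := pP y.
  apply: p_uniq; first exact: linS.
  by rewrite opprD addrACA -scalerBr; exact: linW.
pose pm := GRing.isLinear.Build K V V _ p linp.
pose P : {linear V -> V} := HB.pack p pm.
exists P; split => [v|v Sv]; first by have [] := pP v.
by apply: p_uniq => //; rewrite subrr.
Qed.

(** * Fuzzy numbers built from nondecreasing functions *)

Section monotone_fuzzy.
Context {R : realType}.
Implicit Types (f g : Cbar R) (r s : unitI R).

Lemma unitI_has1 : (1 : R) \in unitI R.
Proof. by rewrite inE /unitI/= in_itv/= ler01 lexx. Qed.

Definition unitI1 : unitI R := exist _ 1 unitI_has1.

Lemma Cbar_cst_subproof (c : R) : (fun _ : unitI R => c) \in Cbar_pred.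
Proof.
rewrite inE; split => [|r _|r _|r _]; last 3 first.
- exact: cvg_cst.
- exact: is_cvg_cst.
- exact: cvg_cst.
- by exists `|c|.
Qed.

Definition Cbar_cst (c : R) : Cbar R := MkCbar (Cbar_cst_subproof c).

(* For x < f 0 the supremum is that of the empty set, which is 0 as intended. *)
Definition monotone_fuzzy_fun f (x : R) : R :=
  if x <= f unitI1 then sup [set val r | r in [set r | f r <= x]] else 0.

Lemma monotone_fuzzy_has_ubound f (x : R) :
  has_ubound [set val r | r in [set r | f r <= x]].
Proof. by exists 1 => _ [r _ <-]; have /andP[] := unitI01 r. Qed.

(** If [x < f r], left continuity gives [s] below [r] with [x < f s]. By monotonicity no parameter
    beyond [s] enters the supremum, which therefore stays below [r]. *)
Lemma monotone_fuzzy_fun_ge f r (x : R) : IC f -> 0 < val r ->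
  (val r <= monotone_fuzzy_fun f x) = (f r <= x <= f unitI1).
Proof.
move=> icf r0; rewrite /monotone_fuzzy_fun andbC.
case: (leP x (f unitI1)) => [xf|_]; last by rewrite leNgt r0.
apply/idP/idP => [|frx]; last first.
  by apply: ub_le_sup; [exact: monotone_fuzzy_has_ubound|exists r].
set X := [set _ | _ in _] => rX; rewrite leNgt; apply/negP => xr.
have e0 : 0 < f r - x by rewrite subr_gt0.
have [s [s0 sr]] := Cbar_approx_left f r _ r0 e0.
rewrite ltr_norml => /andP[_ fs].
have X0 : X !=set0.
  (* The supremum of the empty set is 0, which is below [val r]. *)
  by apply/set0P/eqP => X0; move: rX; rewrite X0 sup0 leNgt r0.
have [_ [t /= ft <-] st] := sup_gt X0 (lt_le_trans sr rX).
by have := icf s t (ltW st); lra.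
Qed.

Lemma monotone_fuzzy_subproof f : IC f -> is_fuzzy_number (monotone_fuzzy_fun f).
Proof.
move=> icf; set u := monotone_fuzzy_fun f.
have u01 x : 0 <= u x <= 1.
  rewrite /u /monotone_fuzzy_fun; case: ifPn => _; last by rewrite lexx ler01.
  set X := [set _ | _ in _].
  have [->|/set0P X0] := eqVneq X set0; first by rewrite sup0 lexx ler01.
  apply/andP; split; last first.
    by apply: ge_sup => // _ [r _ <-]; have /andP[] := unitI01 r.
  have [r Xr] := X0; have [t _ tr] := Xr.
  apply: le_trans (ub_le_sup (monotone_fuzzy_has_ubound f x) Xr).
  by rewrite -tr; have /andP[] := unitI01 t.
(* Superlevel sets at heights in (0, 1] are the intervals from [f r] to [f unitI1]; the remaining
   clauses are read off from them. *)
have uE (a x : R) : 0 < a <= 1 -> exists2 r : unitI R, val r = a &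
    (a <= u x) = (f r <= x <= f unitI1).
  move=> /andP[a0 a1].
  have aI : a \in unitI R by rewrite inE /unitI/= in_itv/= (ltW a0).
  by exists (exist _ a aI) => //; rewrite -monotone_fuzzy_fun_ge.
split => //.
- exists (f unitI1); apply/eqP; rewrite eq_le; have /andP[_ ->] /= := u01 (f unitI1).
  have := monotone_fuzzy_fun_ge f unitI1 (f unitI1) icf ltr01.
  by rewrite !lexx => /= ->.
- move=> t x y /andP[t0 t1]; set m := Num.min _ _.
  have [m0|m0] := leP m 0.
    by apply: le_trans m0 _; have /andP[] := u01 (t * x + (1 - t) * y).
  have m1 : m <= 1 by rewrite ge_min; have /andP[_ ->] := u01 x.
  have m01 : 0 < m <= 1 by rewrite m0 m1.
  have mx : m <= u x by rewrite ge_min lexx.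
  have my : m <= u y by rewrite ge_min lexx orbT.
  have [r rm] := uE m x m01; rewrite mx => /esym/andP[rx xf].
  have [r' r'm] := uE m y m01; rewrite my => /esym/andP[ry yf].
  have {}r'm : r' = r by apply: val_inj; rewrite rm.
  have [s sm ->] := uE m (t * x + (1 - t) * y) m01.
  have -> : s = r by apply: val_inj; rewrite rm.
  rewrite r'm in ry; apply/andP; split; nra.
- move=> x a uxa.
  have [a1|a1] := ltP 1 a.
    by near=> y; apply: le_lt_trans a1; have /andP[] := u01 y.
  have a0 : 0 < a by apply: le_lt_trans uxa; have /andP[] := u01 x.
  have a01 : 0 < a <= 1 by rewrite a0 a1.
  have [r ra uxE] := uE a x a01.
  have uaE y : (u y < a) = (y < f r) || (f unitI1 < y).
    have [s sa uyE] := uE a y a01.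
    have sr : s = r by apply: val_inj; rewrite sa ra.
    by rewrite ltNge uyE sr negb_and -!ltNge.
  move: uxa; rewrite uaE => /orP[xr|xf].
    by near=> y; rewrite uaE; apply/orP; left; near: y; exact: lt_nbhsl.
  by near=> y; rewrite uaE; apply/orP; right; near: y; exact: lt_nbhsr.
- apply: (@bounded_compact_support _ _ `|f|) => x ux0.
  have u01x : 0 < u x <= 1 by rewrite ux0; have /andP[] := u01 x.
  (* Taking the level at the height [u x] itself places [x] between two values of [f]. *)
  have [r _] := uE (u x) x u01x; rewrite lexx => /esym/andP[rx xf].
  have := Cbar_norm_ub f r; have := Cbar_norm_ub f unitI1.
  rewrite -!Cbar_normE !ler_norml => /andP[_ f1] /andP[f2 _].
  by rewrite (le_trans f2 rx) (le_trans xf f1).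
Unshelve. all: by end_near. Qed.

Lemma IC_fuzzy f : IC f ->
  exists u : fuzzy_number R, lower u = f /\ upper u = Cbar_cst (f unitI1).
Proof.
move=> icf; exists (FuzzyNumber (monotone_fuzzy_subproof f icf)).
set u := FuzzyNumber _.
have f1 r : f r <= f unitI1 by apply: (icf r unitI1); have /andP[] := unitI01 r.
have uE r : 0 < val r -> level u (val r) = `[f r, f unitI1]%classic.
  move=> r0; rewrite level_pos//; apply/seteqP.
  by split=> x; rewrite /= in_itv/= -(monotone_fuzzy_fun_ge _ _ _ icf r0).
split; apply: eq_Cbar_pos => r r0.
  by rewrite /= /lower_fun uE// inf_itvcc.
by rewrite /= /upper_fun uE// sup_itvcc.
Qed.

(** The shifted function takes the value [f unitI1 / 2] at 1, which is then the constant upper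
    endpoint and cancels the shift in the sum. *)
Lemma IC_midsum f : IC f -> exists u : fuzzy_number R,
  lower u = f - Cbar_cst (f unitI1 / 2) /\ upper u = Cbar_cst (f unitI1 / 2).
Proof.
move=> icf; have [|u [lu uu]] := IC_fuzzy (f - Cbar_cst (f unitI1 / 2)).
  by move=> r s /icf rs; rewrite lerB.
exists u; split=> //; rewrite uu; apply: val_inj => /=; apply/funext => r /=.
by rewrite [LHS](_ : _ = f unitI1 - f unitI1 / 2)//; lra.
Qed.

Lemma lower_IC (u : fuzzy_number R) : IC (lower u).
Proof. by move=> r s; exact: lower_fun_homo. Qed.

(** * Comparison of the metric with the uniform norm *)

Lemma dist_lower_le (u v : fuzzy_number R) : `|lower u - lower v| <= mdist u v.
Proof.
apply: Cbar_norm_le => r; apply: le_trans (fuzzy_dist_ub u v r).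
by rewrite le_max lexx.
Qed.

Lemma dist_upper_le (u v : fuzzy_number R) : `|upper u - upper v| <= mdist u v.
Proof.
apply: Cbar_norm_le => r; apply: le_trans (fuzzy_dist_ub u v r).
by rewrite le_max lexx orbT.
Qed.

Lemma fuzzy_continuousP (B : fuzzy_number R -> R) : continuous B <->
  forall u e, 0 < e -> exists2 d, 0 < d & forall v, mdist u v < d ->
    `|B u - B v| < e.
Proof.
split => [ctsB u e e0|hB u].
  have FF := nbhs_filter u.
  have /cvgrPdist_lt/(_ e e0)/(@nbhs_ballP _ (fuzzy_number R)) := ctsB u.
  by move=> [d /= d0 hd]; exists d => // v uv; apply: hd; rewrite ballEmdist.
have FF := nbhs_filter u; apply/cvgrPdist_lt => e /(hB u)[d d0 hd].
by apply/(@nbhs_ballP _ (fuzzy_number R)); exists d.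
Qed.

Lemma mdist_le (u v : fuzzy_number R) (d : R) :
  (forall r, `|lower u r - lower v r| <= d) ->
  (forall r, `|upper u r - upper v r| <= d) -> mdist u v <= d.
Proof.
move=> ld ud; apply: ge_sup; first by have [] := fuzzy_dist_has_sup u v.
by move=> _ [r _ <-]; rewrite ge_max ld ud.
Qed.

(** Lower endpoints differ by at most 3/2 of the norm of [f - g] and upper ones by at most 1/2; the
    constant 2 covers both. *)
Lemma mdist_IC_midsum f g (u v : fuzzy_number R) :
  lower u = f - Cbar_cst (f unitI1 / 2) -> upper u = Cbar_cst (f unitI1 / 2) ->
  lower v = g - Cbar_cst (g unitI1 / 2) -> upper v = Cbar_cst (g unitI1 / 2) ->
  mdist u v <= 2 * `|f - g|.
Proof.
move=> lu uu lv uv.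
have fg r : `|f r - g r| <= `|f - g| := Cbar_norm_ub (f - g) r.
have := fg unitI1; rewrite ler_norml => /andP[fg1 fg1'].
apply: mdist_le => r; have := fg r; rewrite !ler_norml => /andP[fgr fgr'].
  have lE (h : Cbar R) : (h - Cbar_cst (h unitI1 / 2)) r = h r - h unitI1 / 2 by [].
  by rewrite lu lv !lE; apply/andP; split; lra.
have uE (h : Cbar R) : Cbar_cst (h unitI1 / 2) r = h unitI1 / 2 by [].
by rewrite uu uv !uE; apply/andP; split; lra.
Qed.

End monotone_fuzzy.

Theorem theorem3p1 (R : realType) (A : fuzzy_number R -> R) :
  (fuzzy_linear A /\ continuous A) <->
  (exists L : {scalar Cbar R},
    (forall x : fuzzy_number R, A x = L (lower x + upper x)) /\
    {within @IC R, continuous L}).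
Proof.
split => [[linA ctsA]|[L [AL ctsL]]]; last first.
  split; first split.
  - by move=> x y; rewrite !AL -!/(midsum _) midsum_add linearD.
  - by move=> l x; rewrite !AL -!/(midsum _) midsum_scale linearZ.
  (* As [L] is continuous only along [IC], it may be composed only with maps staying in [IC]. *)
  have ctsLF (F : fuzzy_number R -> Cbar R) : (forall x, IC (F x)) ->
      (forall x y, `|F x - F y| <= mdist x y) -> continuous (L \o F).
    move=> icF lipF; apply/fuzzy_continuousP => x e e0.
    move/subspace_continuousP: ctsL => /(_ _ (icF x)).
    move=> /cvgrPdist_lt/(_ e e0); rewrite near_withinE => /nbhs_ballP[d /= d0 hd].
    exists d => // y xy; apply: hd; last exact: icF.
    rewrite -ball_normE/=; exact: le_lt_trans (lipF x y) xy.
  have cl := ctsLF _ lower_IC dist_lower_le.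
  have cu : continuous (L \o (fun x => - upper x)).
    (* [upper x] is nonincreasing; its negative is the lower endpoint of the reflection, hence in
       [IC]. *)
    apply: ctsLF => [x|x y]; first by rewrite -lowerN; exact: lower_IC.
    by rewrite -opprD normrN; exact: dist_upper_le.
  have -> : A = (L \o lower) - (L \o (fun x => - upper x)).
    by apply/funext => x; rewrite AL linearD /= !fctE /= linearN opprK.
  by move=> x; have FF := nbhs_filter x; exact: (cvgB (cl x) (cu x)).
have [||P [imP idP]] := linear_projection R (Cbar R) (range (@midsum R)).
- by have [//|u _] := IC_fuzzy (0 : Cbar R); exists (midsum u), u.
- move=> k _ _ [x _ <-] [y _ <-]; exists (fuzzy_add (fuzzy_scale k x) y) => //.
  by rewrite midsum_add midsum_scale.
(* The choice of [x f] is immaterial, since [A] depends only on the [midsum]. *)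
have /choice[x xP] : forall f, exists x, midsum x = P f.
  by move=> f; have [x _ xf] := imP f; exists x.
pose L f := A (x f).
have linL : linear_for *%R L.
  move=> k f g; have [AD AZ] := linA; rewrite /L -AZ -AD.
  apply: fuzzy_linear_midsum => //.
  by rewrite midsum_add midsum_scale !xP linearP.
pose lm := GRing.isLinear.Build R (Cbar R) R _ L linL.
pose L' : {scalar Cbar R} := HB.pack L lm.
(* The projection fixes every [midsum], so there [L'] returns the value of [A]. *)
have L'E (u : fuzzy_number R) f : midsum u = f -> L' f = A u.
  move=> uf; apply: fuzzy_linear_midsum => //; rewrite xP idP//.
  by exists u.
exists L'; split=> [u|]; first by rewrite (L'E u).
apply/subspace_continuousP => f icf; apply/cvgrPdist_lt => e e0.
have [u [lu uu]] := IC_midsum f icf.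
have [d d0 hd] := (fuzzy_continuousP A).1 ctsA u e e0.
(* Half of [d] compensates the Lipschitz constant 2 of [mdist_IC_midsum]. *)
rewrite near_withinE; apply/nbhs_ballP; exists (d / 2) => /=.
  by rewrite divr_gt0.
move=> g; rewrite -ball_normE/= => fg icg.
have [v [lv uv]] := IC_midsum g icg.
suff : `|L' f - L' g| < e by [].
rewrite (L'E u) ?(L'E v); first apply: hd.
- apply: le_lt_trans (mdist_IC_midsum f g u v lu uu lv uv) _.
  by move: fg; lra.
- by rewrite /midsum lv uv subrK.
- by rewrite /midsum lu uu subrK.
Qed.
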